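(* Let $K$ be a field and let $H$ be an $m$-hypergraph of size $n$ with vertex set $\{x_1,\dots,x_n\}$, edge ideal $I(H)\subset K[x_1,\dots,x_n]$ and Alexander dual $I(H)^\vee$. Then an ideal $P\subset K[x_1,\dots,x_n]$ is a non-minimal associated prime of $(I(H)^\vee)^2$ if and only if $P=(x_{i_1},\dots,x_{i_q})$ and there exists a 2-cover $C$ of $H$ that is not the sum of two 1-covers such that $x_{i_j}\overline{C}$ corresponds to a 2-cover that is the sum of two 1-covers for any $j\le q$, and for any $W\notin (x_{i_1},\dots,x_{i_q})$, $W\overline{C}$ does not correspond to a 2-cover that is the sum of two 1-covers.
   Context: An $m$-hypergraph $H$ consists of a finite vertex set $V=\{x_1,\dots,x_n\}$ and an edge set $E$ whose elements are subsets of $V$ containing $m$ distinct elements; its size is $|V|=n$. The vertices are identified with the variables of $K[x_1,\dots,x_n]$. The edge ideal $I(H)$ is the ideal generated by the monomials $x_{i_1}\cdots x_{i_m}$ with $\{x_{i_1},\dots,x_{i_m}\}\in E$. Its Alexander dual is $I(H)^\vee=\bigcap_{\{x_{i_1},\dots,x_{i_m}\}\in E}(x_{i_1},\dots,x_{i_m})$. With $\mathbf{N}=\{0,1,2,\dots\}$, a $k$-cover of $H$ is a nonzero element $(a_1,\dots,a_n)\in\mathbf{N}^n$ such that $a_{i_1}+\cdots+a_{i_m}\ge k$ for every edge $\{x_{i_1},\dots,x_{i_m}\}\in E$. Sums of covers are taken componentwise. A $k$-cover $A=(a_1,\dots,a_n)$ corresponds to the monomial $\overline{A}=x_1^{a_1}\cdots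 x_n^{a_n}$. Here $W$ ranges over elements of $K[x_1,\dots,x_n]$. An associated prime of an ideal $J$ of a ring $R$ means an associated prime of $R/J$; it is non-minimal if it is not minimal among the primes containing $J$.
   Formalization: The hypergraph H is assumed to have at least one edge; with no edges (and n ≥ 1) the dual is the unit ideal, which has no associated primes, yet C = (1,0,…,0) and P = (x_1,…,x_n) satisfy the right-hand condition. *)

(* Defs.v *)
From mathcomp Require Import all_boot all_order all_algebra.
From mathcomp Require Import mpoly.

Set Implicit Arguments.
Unset Strict Implicit.
Unset Printing Implicit Defensive.

Import GRing.Theory.
Local Open Scope ring_scope.

(* The ideals of ring_quotient are boolean predicates; Prop-valued ones are
   used here so that generated ideals, products and annihilators need no
   decidability. *)
Section Ideals.

Variable R : comNzRingType.
Implicit Types (G I J P : R -> Prop).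

Definition is_ideal J : Prop :=
  [/\ J 0, forall f g, J f -> J g -> J (f + g) & forall a f, J f -> J (a * f)].

Definition prime_ideal P : Prop :=
  [/\ is_ideal P, ~ P 1 & forall f g, P (f * g) -> P f \/ P g].

Definition gen_ideal G : R -> Prop :=
  fun f => forall J, is_ideal J -> (forall g, G g -> J g) -> J f.

Definition ideal_mul I J : R -> Prop :=
  gen_ideal (fun f => exists a b, [/\ I a, J b & f = a * b]).

Definition ideal_sqr J : R -> Prop := ideal_mul J J.

(* P is prime and is the annihilator of the class of some f in R / J. *)
Definition associated_prime J P : Prop :=
  prime_ideal P /\ exists f, forall g, P g <-> J (g * f).

Definition minimal_prime J P : Prop :=
  [/\ prime_ideal P, forall f, J f -> P f &
      forall Q : R -> Prop, prime_ideal Q -> (forall f, J f -> Q f) ->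
        (forall f, Q f -> P f) -> forall f, P f -> Q f].

Definition nonminimal_associated_prime J P : Prop :=
  associated_prime J P /\ ~ minimal_prime J P.

End Ideals.

Record hypergraph (m n : nat) := Hypergraph {
  edges : {set {set 'I_n}};
  card_edge : forall e, e \in edges -> #|e| = m
}.

Section Covers.

Variables (m n : nat) (H : hypergraph m n).

Definition is_cover (k : nat) (A : 'X_{1..n}) : Prop :=
  A != 0%MM /\ forall e, e \in edges H -> (k <= \sum_(i in e) A i)%N.

Definition sum_of_two_1covers (C : 'X_{1..n}) : Prop :=
  exists A B, [/\ is_cover 1 A, is_cover 1 B & C = (A + B)%MM].

End Covers.

Section Dual.

Variables (K : fieldType) (m n : nat).

Definition var_ideal (S : {set 'I_n}) : {mpoly K[n]} -> Prop :=
  gen_ideal (fun f => exists2 i, i \in S & f = 'X_i).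

(* The Alexander dual of the edge ideal of H. *)
Definition alexander_dual (H : hypergraph m n) : {mpoly K[n]} -> Prop :=
  fun f => forall e, e \in edges H -> var_ideal e f.

Definition corresponds_to_split_2cover
    (H : hypergraph m n) (f : {mpoly K[n]}) : Prop :=
  exists D, [/\ is_cover H 2 D, sum_of_two_1covers H D & f = 'X_[D]].

End Dual.

Arguments var_ideal K {n} S _.
Arguments alexander_dual K {m n} H _.

(* Main.v *)
Require Import Defs.
From mathcomp Require Import all_boot all_order all_algebra.
From mathcomp Require Import mpoly.
From mathcomp Require Import ring boolp.

Set Implicit Arguments.
Unset Strict Implicit.
Unset Printing Implicit Defensive.

Import GRing.Theory.
Local Open Scope ring_scope.

(** Let J be the dual ideal. A monomial lies in J exactly when its exponent is a
    1-cover, so J^2 is the monomial ideal whose monomials are the sums of two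
    1-covers (ideal_sqr_dualE); here 1-covers are stable under adding
    any exponent, so no further closure is needed.

    An associated prime of a monomial ideal is the annihilator of a single
    monomial X^C and is itself a monomial ideal (associated_prime_monomial);
    being prime, it is generated by a set S of variables (prime_monomial_vars).
    Thus the associated primes P of J^2 are the ideals P_S generated by the
    variables in S for which some C satisfies: X^C is not in J^2, multiplying
    X^C by a variable of S leads into J^2, and multiplying it by an element
    outside P_S does not; as J^2 and P_S are monomial ideals, the last condition
    need only be tested on monomials. It remains to see that P_S is non-minimal
    exactly when C is a 2-cover.

    The edges all have m elements, so none contains another, and the
    minimal primes of J^2 are the P_e with e an edge (minimal_prime_edge,
    edge_subset). If C is not a 2-cover, then C has weight at most 1 on an
    edge e; a variable x_i outside e would leave this weight unchanged, so
    x_i X^C would not be in J^2. Hence S is contained in e, and P_S = P_e is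
    minimal. Conversely, if P_S = P_e is minimal and C is a 2-cover, then
    multiplying X^C by the square of the product of the variables outside e
    gives a sum of two 1-covers (cover2_split_outside), although this factor
    is not in P_e: a contradiction. *)

(** * Monomial ideals and their associated primes *)

Section MonomialIdeals.

Variables (K : fieldType) (n : nat).
Implicit Types (f g : {mpoly K[n]}) (a b c : 'X_{1..n}) (i : 'I_n).
Implicit Types (M : 'X_{1..n} -> Prop) (S : {set 'I_n}).
Implicit Types (P J : {mpoly K[n]} -> Prop).

(** The polynomials all of whose monomials have an exponent satisfying M. This
    is the ideal spanned by those monomials when M is stable under adding
    exponents. *)
Definition monomial_ideal M : {mpoly K[n]} -> Prop :=
  fun f => forall a, a \in msupp f -> M a.

(** Stability of M under multiplication by monomials. *)
Definition upward M : Prop := forall a b, M b -> M (a + b)%MM.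

Lemma monomial_idealX M a : monomial_ideal M 'X_[a] <-> M a.
Proof.
split=> [h|h b]; first by apply: h; rewrite msuppX inE.
by rewrite msuppX inE => /eqP->.
Qed.

Lemma is_ideal_monomial M : upward M -> is_ideal (monomial_ideal M).
Proof.
move=> upM; split=> [a|f g Mf Mg a|f g Mg a].
- by rewrite mcoeff_msupp mcoeff0 eqxx.
- by move/msuppD_le; rewrite mem_cat => /orP[/Mf|/Mg].
- move/msuppM_le/allpairsP=> [[b c] /= [_ /Mg Mc ->]]; exact: upM.
Qed.

Lemma ideal_sum_monomials J f : is_ideal J ->
  (forall a, a \in msupp f -> J 'X_[a]) -> J f.
Proof.
move=> [J0 JD JM] Jf; rewrite [f]mpolyE big_seq.
by elim/big_ind: _ => // a /Jf Ja; rewrite -mul_mpolyC; apply: JM.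
Qed.

Lemma is_ideal_gen (G : {mpoly K[n]} -> Prop) : is_ideal (gen_ideal G).
Proof.
split=> [J [] //|f g hf hg J idJ GJ|f g hg J idJ GJ]; case: (idJ) => _ JD JM.
  by apply: (JD); [apply: hf | apply: hg].
by apply: JM; apply: hg.
Qed.

Lemma monomial_idealMX M f a :
  monomial_ideal M (f * 'X_[a]) <-> monomial_ideal (fun b => M (b + a)%MM) f.
Proof.
split=> h b.
  by move=> bf; apply: h; rewrite mcoeff_msupp addmC mcoeffMX -mcoeff_msupp.
by rewrite (perm_mem (msuppMX _ _)) => /mapP[c cf ->]; rewrite addmC; apply: h.
Qed.

(** The monomial X^a is divisible by a variable indexed by S. *)
Definition divisible_by_var S a : Prop := exists2 i, i \in S & (0 < a i)%N.

Lemma upward_divisible S : upward (divisible_by_var S).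
Proof. by move=> a b [i iS bi]; exists i => //; rewrite mnmDE addn_gt0 bi orbT. Qed.

Lemma mnm_split_var a i : (0 < a i)%N -> exists b, a = (b + U_(i))%MM.
Proof.
move=> ai; exists (a - U_(i))%MM; rewrite submK //.
by apply/mnm_lepP=> j; rewrite mnm1E; case: eqP => [<-|].
Qed.

Lemma var_idealE S f :
  var_ideal K S f <-> monomial_ideal (divisible_by_var S) f.
Proof.
split=> [|h].
  apply; first exact: is_ideal_monomial (@upward_divisible S).
  move=> _ [i iS ->]; apply/monomial_idealX; exists i => //.
  by rewrite mnm1E eqxx.
have idV : is_ideal (var_ideal K S) by apply: is_ideal_gen.
apply: ideal_sum_monomials => // a /h[i iS /mnm_split_var[b ->]].
rewrite mpolyXD; case: (idV) => _ _; apply=> J _; apply; by exists i.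
Qed.

(** A monomial ideal is prime as soon as the primality condition holds for
    monomials. Terms already in the ideal may be discarded from both factors;
    the leading monomial of the product of what remains is then the sum of two
    exponents outside M. *)
Lemma prime_monomial_ideal M : upward M -> ~ M 0%MM ->
  (forall a b, M (a + b)%MM -> M a \/ M b) -> prime_ideal (monomial_ideal M).
Proof.
move=> upM M0 primeM; have idM := is_ideal_monomial upM.
split=> // [|f g].
  by move=> h1; apply: M0; apply/monomial_idealX; rewrite mpolyX0.
(* The part of h supported outside M. *)
pose t (h : {mpoly K[n]}) : {mpoly K[n]} :=
  h - \sum_(a <- msupp h | `[< M a >]) h@_a *: 'X_[a].
have tE h b : (t h)@_b = if `[< M b >] then 0 else h@_b.
  rewrite mcoeffB (raddf_sum (mcoeff b)) /=.
  have [bh|bh] := boolP (b \in msupp h); last first.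
    rewrite (memN_msupp_eq0 bh) big1 ?subrr ?if_same // => a _.
    rewrite mcoeffZ mcoeffX; case: eqP => [->|_]; last by rewrite mulr0.
    by rewrite (memN_msupp_eq0 bh) mul0r.
  rewrite big_mkcond (bigD1_seq b) ?msupp_uniq //= big1 => [|a ab].
    rewrite addr0; case: ifP; last by rewrite subr0.
    by rewrite mcoeffZ mcoeffX eqxx mulr1 subrr.
  by case: ifP => // _; rewrite mcoeffZ mcoeffX (negPf ab) mulr0.
have Mt h : monomial_ideal M (h - t h).
  move=> b; rewrite mcoeff_msupp mcoeffB tE; case: ifP => [/asboolP //|_].
  by rewrite subrr eqxx.
have tN h b : b \in msupp (t h) -> ~ M b.
  by rewrite mcoeff_msupp tE; case: ifP => [_|/asboolP //]; rewrite eqxx.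
have [_ MD MM] := idM; move=> Mfg.
have Mtt : monomial_ideal M (t f * t g).
  have -> : t f * t g = f * g + ((- t g) * (f - t f) + (- f) * (g - t g)).
    by move: (t f) (t g) => *; ring.
  by apply: (MD) => //; apply: (MD); apply: (MM).
have tM h : t h = 0 -> monomial_ideal M h.
  by move=> h0; rewrite -[h]subr0 -h0.
have [/tM|f0] := eqVneq (t f) 0; first by left.
have [/tM|g0] := eqVneq (t g) 0; first by right.
have /Mtt : mlead (t f * t g) \in msupp (t f * t g).
  by rewrite mlead_supp // mulf_neq0.
rewrite mleadM // => /primeM[] h; exfalso.
  exact: (tN f _ (mlead_supp f0)) h.
exact: (tN g _ (mlead_supp g0)) h.
Qed.

Lemma prime_var_ideal S : prime_ideal (monomial_ideal (divisible_by_var S)).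
Proof.
apply: prime_monomial_ideal => [||a b [i iS]].
- exact: upward_divisible.
- by case=> i _; rewrite mnm0E.
- by rewrite mnmDE addn_gt0 => /orP[]; [left | right]; exists i.
Qed.

(** An associated prime of a monomial ideal is the annihilator of a monomial.
    Among the polynomials f with annihilator P, one with the fewest terms is
    chosen; its leading monomial then has annihilator P as well. *)
Lemma associated_prime_monomial M P : upward M ->
  associated_prime (monomial_ideal M) P ->
  exists a, forall g, P g <-> monomial_ideal M (g * 'X_[a]).
Proof.
move=> upM [primeP [f0 annf0]]; have [_ MD MM] := is_ideal_monomial upM.
have [idP P1 PM] := primeP.
pose ann f := forall g, P g <-> monomial_ideal M (g * f).
have [f [annf minf]] : exists f, ann f /\
    forall f', ann f' -> (size (msupp f) <= size (msupp f'))%N.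
  pose Q k := `[< exists2 f, ann f & size (msupp f) = k >].
  have exQ : exists k, Q k by exists (size (msupp f0)); apply/asboolP; exists f0.
  case: (ex_minnP exQ) => k /asboolP[f annf sf] mink.
  exists f; split=> // f' annf'; rewrite sf; apply: mink.
  by apply/asboolP; exists f'.
(* If a monomial X^b outside P sends a term of f into the ideal, then X^b times
   f without that term still has annihilator P, against the choice of f. *)
have Pmon a b : a \in msupp f -> M (b + a)%MM -> P 'X_[b].
  move=> af Mba; apply: contrapT => Pb.
  pose f' := f - f@_a *: 'X_[a].
  have Mb : monomial_ideal M ('X_[b] * (f@_a *: 'X_[a])).
    by rewrite -mul_mpolyC mulrCA; apply: (MM); rewrite -mpolyXD; apply/monomial_idealX.
  have ann' : ann ('X_[b] * f').
    move=> g; split=> [Pg|Mg].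
      rewrite !mulrBr; apply: (MD); last first.
        by rewrite -mulrN -mulN1r; apply: (MM); apply: (MM).
      by rewrite mulrCA; apply: (MM); apply/annf.
    suff /PM[] : P (g * 'X_[b]) by [].
    apply/annf; rewrite -mulrA.
    have -> : 'X_[b] * f = 'X_[b] * f' + 'X_[b] * (f@_a *: 'X_[a]).
      by rewrite -mulrDr subrK.
    by rewrite mulrDr; apply: (MD) => //; apply: (MM).
  have := minf _ ann'; rewrite mulrC (perm_size (msuppMX _ _)).
  rewrite (size_map _ (msupp f')) /f'.
  rewrite (perm_size (msupp_rem _ _)) size_rem // leqNgt ltn_predL.
  by case: (msupp f) af.
have fN0 : f != 0.
  apply/eqP=> f0E; apply: P1; apply/annf; rewrite f0E mulr0.
  by case: (is_ideal_monomial upM).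
have leadf := mlead_supp fN0.
(* P is a monomial ideal: the leading terms of g and f multiply to the leading
   term of gf, which lies in the ideal, so the leading monomial of g is in P;
   it can be removed from g. *)
have Psupp g : P g -> forall b, b \in msupp g -> P 'X_[b].
  have [k] := ubnP (size (msupp g)); elim: k g => // k IH g ltk Pg b bg.
  have gN0 : g != 0 by apply/eqP=> g0; rewrite g0 msupp0 in bg.
  have Pl : P 'X_[mlead g].
    apply: (Pmon _ _ leadf); rewrite -mleadM //; apply: (annf g).1 => //.
    by rewrite mlead_supp // mulf_neq0.
  have [->//|bl] := eqVneq b (mlead g).
  case: idP => _ PD PMl; have leadg := mlead_supp gN0.
  apply: (IH (g - g@_(mlead g) *: 'X_[mlead g])).
  - rewrite (perm_size (msupp_rem _ _)) size_rem //.
    by move: ltk leadg; case: (msupp g) => //= ? ?; rewrite ltnS.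
  - by apply: PD => //; rewrite -mul_mpolyC -mulNr; apply: (PMl).
  by rewrite (perm_mem (msupp_rem _ _)) mem_rem_uniq ?msupp_uniq // inE bl.
exists (mlead f) => g; rewrite monomial_idealMX; split=> [Pg b bg|h].
  have /annf/(_ (b + mlead f)%MM) := Psupp _ Pg _ bg.
  apply; rewrite mulrC (perm_mem (msuppMX _ _)); exact: map_f.
by apply: ideal_sum_monomials => // b /h; apply: Pmon.
Qed.

(** A prime monomial ideal is generated by variables. *)
Lemma prime_monomial_vars P : prime_ideal P ->
  (forall g, P g -> forall a, a \in msupp g -> P 'X_[a]) ->
  exists S, forall g, P g <-> monomial_ideal (divisible_by_var S) g.
Proof.
move=> [idP P1 PM] Psupp; have [_ _ PMl] := idP.
pose S := [set i | `[< P 'X_i >]].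
exists S => g; split=> [Pg b /(Psupp g Pg)|h]; last first.
  apply: ideal_sum_monomials => // b /h[i]; rewrite inE => /asboolP Pi.
  by move=> /mnm_split_var[c ->]; rewrite mpolyXD; apply: (PMl).
have [k] := ubnP (mdeg b); elim: k b => // k IH b; rewrite ltnS => bk Pb.
have [i bi] : exists i, (0 < b i)%N.
  apply: contrapT => b0; apply: P1; rewrite -mpolyX0.
  suff <- : b = 0%MM by [].
  by apply/mnmP=> i; rewrite mnm0E; apply/eqP; rewrite -leqn0 leqNgt;
    apply/negP=> bi; apply: b0; exists i.
have [c bE] := mnm_split_var bi; move: Pb; rewrite bE mpolyXD => /PM[Pc|Pi].
  rewrite addmC; apply: upward_divisible; apply: IH => //.
  by apply: leq_trans bk; rewrite bE mdegD mdeg1 addn1.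
exists i; first by rewrite inE; apply/asboolP.
by rewrite -bE.
Qed.

End MonomialIdeals.

(** * Covers and the square of the dual ideal *)

Section Covers.

Variables (K : fieldType) (m n : nat) (H : hypergraph m n).
Hypothesis H_nonempty : edges H != set0.
Implicit Types (a b A : 'X_{1..n}) (e S : {set 'I_n}) (i : 'I_n).

(** As H has an edge, the requirement that a (k+1)-cover be nonzero is
    automatic. *)
Lemma is_coverP k A : is_cover H k.+1 A <->
  forall e, e \in edges H -> (k < \sum_(i in e) A i)%N.
Proof.
split=> [[] //|cA]; split=> //; apply/eqP=> A0.
have /set0Pn[e /cA] := H_nonempty.
by rewrite big1 // => i _; rewrite A0 mnm0E.
Qed.

Lemma sum_gt0_divisible e A :
  (0 < \sum_(i in e) A i)%N <-> divisible_by_var e A.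
Proof.
split=> [|[i ie Ai]]; last by rewrite (bigD1 i) //= addn_gt0 Ai.
rewrite lt0n sum_nat_eq0 negb_forall => /existsP[i].
by rewrite negb_imply -lt0n => /andP[ie Ai]; exists i.
Qed.

Lemma is_cover1P A : is_cover H 1 A <->
  forall e, e \in edges H -> divisible_by_var e A.
Proof.
by rewrite is_coverP; split=> cA e /cA /sum_gt0_divisible.
Qed.

Lemma upward_cover1 : upward (is_cover H 1).
Proof.
move=> a b /is_cover1P cb; apply/is_cover1P=> e /cb.
exact: upward_divisible.
Qed.

Lemma upward_split : upward (sum_of_two_1covers H).
Proof.
move=> a _ [A [B [cA cB ->]]]; exists (a + A)%MM, B; split=> //.
  exact: upward_cover1.
by rewrite addmA.
Qed.

Lemma split_is_cover2 a : sum_of_two_1covers H a -> is_cover H 2 a.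
Proof.
move=> [A [B [/is_coverP cA /is_coverP cB ->]]]; apply/is_coverP=> e eH.
under eq_bigr do rewrite mnmDE.
by rewrite big_split /=; apply: leq_add (cA e eH) (cB e eH).
Qed.

Lemma alexander_dualE f :
  alexander_dual K H f <-> monomial_ideal (is_cover H 1) f.
Proof.
split=> [h a af|h e eH].
  by apply/is_cover1P=> e /h/var_idealE/(_ a af).
by apply/var_idealE=> a /h/is_cover1P/(_ e eH).
Qed.

Lemma ideal_sqr_dualE f : ideal_sqr (alexander_dual K H) f <->
  monomial_ideal (sum_of_two_1covers H) f.
Proof.
split=> [|h].
  apply; first exact: is_ideal_monomial upward_split.
  move=> _ [g [h [/alexander_dualE cg /alexander_dualE ch ->]]] a.
  move=> /msuppM_le/allpairsP[[b c] /= [/cg cb /ch cc ->]].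
  by exists b, c.
apply: ideal_sum_monomials => [|a /h[A [B [cA cB ->]]]]; first exact: is_ideal_gen.
move=> J _; apply; exists 'X_[A], 'X_[B].
by split; rewrite ?mpolyXD //; apply/alexander_dualE/monomial_idealX.
Qed.

Lemma corresponds_splitE (f : {mpoly K[n]}) : corresponds_to_split_2cover H f <->
  exists2 a, sum_of_two_1covers H a & f = 'X_[a].
Proof.
split=> [[a [_ sa ->]]|[a sa ->]]; first by exists a.
by exists a; split=> //; apply: split_is_cover2.
Qed.

(** The exponent of the product of the variables outside e. *)
Definition outside e : 'X_{1..n} := [multinom (i \notin e : nat) | i < n].

Lemma divisible_outside S e : divisible_by_var S (outside e) <-> ~~ (S \subset e).
Proof.
split=> [[i iS]|/subsetPn[i iS ie]].
  by rewrite mnmE lt0b => ie; apply/subsetPn; exists i.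
by exists i; rewrite // mnmE ie.
Qed.

(** Edges have the same cardinality, so none strictly contains another. *)
Lemma edge_antichain e e' :
  e \in edges H -> e' \in edges H -> e' \subset e -> e' = e.
Proof.
move=> eH e'H e'e; apply/eqP.
by rewrite eqEcard e'e (card_edge eH) (card_edge e'H) leqnn.
Qed.

Lemma cover1_edge e i :
  e \in edges H -> i \in e -> is_cover H 1 (U_(i) + outside e)%MM.
Proof.
move=> eH ie; apply/is_cover1P=> e' e'H.
have [e'e|e'e] := boolP (e' \subset e); last first.
  by apply: upward_divisible; apply/divisible_outside.
rewrite (edge_antichain eH e'H e'e).
by exists i; rewrite // mnmDE mnm1E eqxx.
Qed.

(** If no edge lay in S, the product of the variables outside S would be in
    the dual ideal, and its square would have to be divisible by a variable
    in S. *)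
Lemma edge_subset S :
  (forall f, ideal_sqr (alexander_dual K H) f -> var_ideal K S f) ->
  exists2 e, e \in edges H & e \subset S.
Proof.
move=> JS; apply: contrapT => noe.
have cS : is_cover H 1 (outside S).
  apply/is_cover1P=> e eH; apply/divisible_outside/negP=> eS; apply: noe.
  by exists e.
have /JS/var_idealE/monomial_idealX[i iS] :
    ideal_sqr (alexander_dual K H) 'X_[outside S + outside S].
  by apply/ideal_sqr_dualE/monomial_idealX; exists (outside S), (outside S).
by rewrite mnmDE mnmE iS.
Qed.

Lemma split_sub_var e f : e \in edges H ->
  ideal_sqr (alexander_dual K H) f -> var_ideal K e f.
Proof.
move=> eH /ideal_sqr_dualE h; apply/var_idealE=> a /h[A [B [_ /is_cover1P cB ->]]].
by apply: upward_divisible; apply: cB.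
Qed.

(** For i in e, the product p of x_i and the variables outside e is in the dual
    ideal. So p^2, hence p, is in any prime Q containing the square of that
    ideal; if Q lies in the ideal generated by e, it contains x_i. *)
Lemma minimal_prime_edge e : e \in edges H ->
  minimal_prime (ideal_sqr (alexander_dual K H)) (monomial_ideal (divisible_by_var e)).
Proof.
move=> eH; split=> [||Q primeQ JQ Qe f fe]; first exact: prime_var_ideal.
  by move=> f /(split_sub_var eH)/var_idealE.
have [idQ _ QM] := primeQ; apply: (ideal_sum_monomials idQ) => a /fe[i ie].
move=> /mnm_split_var[b ->]; rewrite mpolyXD; case: idQ => _ _; apply.
have /JQ : ideal_sqr (alexander_dual K H)
    ('X_[(U_(i) + outside e)] * 'X_[(U_(i) + outside e)]).
  rewrite -mpolyXD; apply/ideal_sqr_dualE/monomial_idealX.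
  by exists (U_(i) + outside e)%MM, (U_(i) + outside e)%MM; split=> //;
    apply: cover1_edge.
suff Qout : ~ Q 'X_[outside e] by rewrite mpolyXD => /QM[] /QM[].
by move=> /Qe/monomial_idealX/divisible_outside; rewrite subxx.
Qed.

(** A 2-cover splits once its weight is raised by 2 outside an edge e: take out
    one unit at some i in e together with the variables outside e. Both parts
    are positive somewhere on e, since a has weight at least 2 on e, and every
    other edge has a vertex outside e. *)
Lemma cover2_split_outside e a : e \in edges H -> is_cover H 2 a ->
  sum_of_two_1covers H (outside e + outside e + a)%MM.
Proof.
move=> eH /is_coverP ca.
have [i ie ai] : divisible_by_var e a.
  by move: e eH; apply/is_cover1P/is_coverP=> e /ca; apply: ltnW.
have [b aE] := mnm_split_var ai.
exists (U_(i) + outside e)%MM, (outside e + b)%MM; split; first exact: cover1_edge.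
  apply/is_cover1P=> e' e'H.
  have [e'e|e'e] := boolP (e' \subset e); last first.
    by rewrite addmC; apply: upward_divisible; apply/divisible_outside.
  rewrite (edge_antichain eH e'H e'e).
  apply/upward_divisible/sum_gt0_divisible; have := ca e eH.
  rewrite aE; under eq_bigr do rewrite mnmDE mnm1E.
  rewrite big_split /= [X in (_ + X)%N](bigD1 i ie) /= eqxx.
  rewrite [X in (_ + (_ + X))%N]big1 ?addn0 ?addn1 // => j /andP[_].
  by rewrite eq_sym => /negPf->.
by apply/mnmP=> j; rewrite aE !mnmDE; ring.
Qed.

End Covers.

Theorem theorem1p4 (K : fieldType) (m n : nat) (H : hypergraph m n)
    (H_nonempty : edges H != set0)
    (P : {mpoly K[n]} -> Prop) (P_ideal : is_ideal P) :
  nonminimal_associated_prime (ideal_sqr (alexander_dual K H)) P <->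
  exists S : {set 'I_n},
    (forall f, P f <-> var_ideal K S f) /\
    exists C : 'X_{1..n},
      [/\ is_cover H 2 C,
          ~ sum_of_two_1covers H C,
          forall i, i \in S -> corresponds_to_split_2cover H ('X_i * 'X_[K, C]) &
          forall W : {mpoly K[n]}, ~ var_ideal K S W ->
            ~ corresponds_to_split_2cover H (W * 'X_[C])].
Proof.
have JE := @ideal_sqr_dualE K m n H H_nonempty.
have upS := @upward_split m n H H_nonempty.
split=> [[[primeP [f annf]] nonmin]|[S [PE [C [c2C nsC vC WC]]]]].
  have [C annC] : exists C, forall g, P g <->
      monomial_ideal (sum_of_two_1covers H) (g * 'X_[C]).
    apply: associated_prime_monomial => //; split=> //.
    by exists f => g; rewrite annf JE.
  have Psupp g : P g -> forall a, a \in msupp g -> P 'X_[a].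
    move=> /annC/monomial_idealMX h a /h sa.
    by apply/annC; rewrite -mpolyXD; apply/monomial_idealX.
  have [S PE] := prime_monomial_vars primeP Psupp.
  have PvE g : P g <-> var_ideal K S g by rewrite PE var_idealE.
  have JP g : ideal_sqr (alexander_dual K H) g -> P g.
    move=> /JE Jg; apply/annC; rewrite mulrC.
    by case: (is_ideal_monomial K upS) => _ _; apply.
  exists S; split=> //; exists C; split.
  (* Otherwise C has weight at most 1 on an edge e, and P turns out to be the
     minimal prime generated by e. *)
  - apply/is_coverP=> // e eH; rewrite ltnNge; apply/negP=> Ce.
    have [e' e'H e'S] : exists2 e', e' \in edges H & e' \subset S.
      by apply: (edge_subset (K := K)) => // g /JP/PvE.
    have Se : S \subset e.
      apply/subsetP=> i iS; apply: contrapT => /negP ie.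
      have /annC : P 'X_i.
        by apply/PE/monomial_idealX; exists i; rewrite // mnm1E eqxx.
      (* x_i X^C has the same weight on e as X^C. *)
      rewrite -mpolyXD => /monomial_idealX/split_is_cover2-/(_ H_nonempty).
      move=> /is_coverP-/(_ H_nonempty e eH); rewrite ltnNge => /negP; apply.
      under eq_bigr do rewrite mnmDE mnm1E.
      rewrite big_split /= big1 // => j je.
      by case: eqP => // ij; rewrite ij je in ie.
    have SE : S = e.
      apply/eqP; rewrite eqEsubset Se /=.
      by rewrite -(edge_antichain eH e'H (subset_trans e'S Se)).
    apply: nonmin; have [minp1 minp2 minp3] := minimal_prime_edge K H_nonempty eH.
    rewrite -SE in minp3.
    split=> // Q primeQ JQ QP g /PE; apply: minp3 => // h /QP/PE //.
  - move=> sC; case: primeP => _ + _; apply; apply/annC.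
    by rewrite mul1r; apply/monomial_idealX.
  - move=> i iS; apply/corresponds_splitE => //; exists (U_(i) + C)%MM.
      apply/(@monomial_idealX K); rewrite mpolyXD; apply/annC/PE/monomial_idealX.
      by exists i; rewrite // mnm1E eqxx.
    by rewrite mpolyXD.
  - move=> W WS /(corresponds_splitE H_nonempty)[a sa WE].
    by apply: WS; apply/PvE/annC; rewrite WE; apply/monomial_idealX.
have PmE g : P g <-> monomial_ideal (divisible_by_var S) g by rewrite PE var_idealE.
have outS a : ~ divisible_by_var S a -> ~ sum_of_two_1covers H (a + C)%MM.
  move=> aS sa; apply: (WC 'X_[a]); first by rewrite var_idealE monomial_idealX.
  by apply/corresponds_splitE=> //; exists (a + C)%MM; rewrite ?mpolyXD.
have primeP : prime_ideal P.
  have [_ q1 q2] := prime_var_ideal K S.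
  split=> // [/PmE //|g h /PmE/q2[]]; first by left; apply/PmE.
  by right; apply/PmE.
split.
  split=> //; exists 'X_[C] => g; rewrite JE; split=> [/PmE h|/monomial_idealMX h].
    apply/monomial_idealMX=> a /h[i iS /mnm_split_var[b ->]].
    have /(corresponds_splitE H_nonempty)[d sd] := vC i iS.
    rewrite -mpolyXD -addmA => dE; apply: upS.
    by apply/(@monomial_idealX K); rewrite dE; apply/monomial_idealX.
  by apply/PmE=> a /h sa; apply: contrapT => /outS.
(* If P were minimal, S would be an edge e, and the square of the product of the
   variables outside e would contradict the condition on the W not in P. *)
move=> [_ JP minP].
have [e eH eS] : exists2 e, e \in edges H & e \subset S.
  by apply: (edge_subset (K := K)) => // g /JP/PE.
have Se : S \subset e.
  apply/subsetP=> i iS.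
  suff /monomial_idealX[j je] : monomial_ideal (divisible_by_var e) ('X_i : {mpoly K[n]}).
    by rewrite mnm1E; case: eqP => [->|].
  apply: minP; first exact: prime_var_ideal.
  - by move=> g /(split_sub_var H_nonempty eH)/var_idealE.
  - move=> g h; apply/PmE=> a /h[j je aj]; exists j => //; exact: subsetP eS j je.
  by apply/PmE/monomial_idealX; exists i; rewrite // mnm1E eqxx.
apply: (outS (outside e + outside e)%MM); last exact: cover2_split_outside.
by case=> i /(subsetP Se) ie; rewrite mnmDE mnmE ie.
Qed.
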